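(* For all $n \ge 0$, the map $\varphi$ is a bijection between $\mathcal{M}_n$ and $I_n(3412)$ such that $\tau_k(\varphi(\pi)) = \tau_k(\pi)$ for all integers $k$ and all $\pi \in \mathcal{M}_n$.
   Context: A Motzkin path of length $n$ is a lattice path from $(0,0)$ to $(n,0)$ consisting of up steps $U=(1,1)$, down steps $D=(1,-1)$ and level steps $L=(1,0)$ which does not pass below the line $y=0$; $\mathcal{M}_n$ is the set of these paths (including the empty path when $n=0$). The height $ht(s)$ of a step $s$ is the $y$-coordinate of its left-most point. For a Motzkin path $\pi$ and an integer $k$, $$\tau_k(\pi) = \sum_{s} \binom{2\,ht(s)}{k-1} + \sum_{s} \binom{2\,ht(s)-1}{k-1},$$ where the first sum is over all up and level steps $s$ of $\pi$ and the second is over all down steps $s$ of $\pi$; here $\binom{n}{k}=0$ whenever $k<0$ or $k>n$. $I_n(3412)$ is the set of involutions of $\{1,\ldots,n\}$ (in one-line notation) which avoid $3412$, i.e. have no subsequence in the same relative order as $3412$. For a permutation $\pi$ and $k\ge 1$, $\tau_k(\pi)$ is the number of decreasing subsequences of length $k$ in $\pi$, and $\tau_k(\pi)=0$ for $k \le 0$. For $\pi \in \mathcal{M}_n$, $\varphi(\pi)$ is the permutation obtained as follows. Number the steps of $\pi$ from left to right with $1,2,\ldots,n$. For each up step at height $h$, find the first down step at height $h+1$ to its right and switch the labels of the two steps. Then $\varphi(\pi)$ is the result of reading the resulting labels from left to right. (For example, $\varphi(ULUDDLUD)=52431687$.) *)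

(* Defs.v *)
From HB Require Import structures.
From mathcomp Require Import all_boot all_order all_fingroup all_algebra.

Set Implicit Arguments.
Unset Strict Implicit.
Unset Printing Implicit Defensive.

Import GRing.Theory.
Local Open Scope ring_scope.

(* Positions and values of one-line notation are 0-based: a permutation of    *)
(* {1, ..., n} is s : 'S_n, whose i-th entry (i = 1, ..., n) is s (i-1) + 1.  *)
(* The steps of a path are numbered by 'I_n in the same way.                  *)

Inductive step : predArgType := Up | Down | Level.

Definition step_code (s : step) : option bool :=
  match s with Up => Some true | Down => Some false | Level => None end.
Definition step_decode (c : option bool) : step :=
  match c with Some true => Up | Some false => Down | None => Level end.
Lemma step_codeK : cancel step_code step_decode.
Proof. by case. Qed.
HB.instance Definition _ := Countable.copy step (can_type step_codeK).
HB.instance Definition _ : isFinite step := CanIsFinite step_codeK.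

Definition rise (s : step) : int :=
  match s with Up => 1 | Down => -1 | Level => 0 end.

(* The y-coordinate reached after the first i steps; this is also the height  *)
(* (y-coordinate of the left endpoint) of the step with 0-based index i.      *)
Definition height (p : seq step) (i : nat) : int :=
  \sum_(s <- take i p) rise s.

Definition motzkin (n : nat) : {set n.-tuple step} :=
  [set p : n.-tuple step |
    [forall i : 'I_n.+1, 0 <= height p i] && (height p n == 0)].

Definition binz (n k : int) : nat :=
  if (0 <= k) && (k <= n) then 'C(`|n|, `|k|)%N else 0%N.

Definition path_tau (n : nat) (k : int) (p : n.-tuple step) : nat :=
  (\sum_(i < n | tnth p i != Down) binz (2 * height p i)%R (k - 1)%R
   + \sum_(i < n | tnth p i == Down) binz (2 * height p i - 1)%R (k - 1)%R)%N.

(* A subsequence of s is given by the set A of its positions.                 *)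
Definition decreasing_on (n : nat) (s : 'S_n) (A : {set 'I_n}) : bool :=
  [forall i in A, forall j in A, (i < j)%N ==> (s j < s i)%N].

Definition perm_tau (n : nat) (k : int) (s : 'S_n) : nat :=
  if 1 <= k then
    #|[set A : {set 'I_n} | (#|A|%:Z == k) && decreasing_on s A]|
  else 0%N.

Definition contains_pattern (q : seq nat) (n : nat) (s : 'S_n) : bool :=
  [exists f : {ffun 'I_(size q) -> 'I_n},
    [forall i : 'I_(size q), forall j : 'I_(size q),
       (i < j)%N ==> (f i < f j)%N] &&
    [forall i : 'I_(size q), forall j : 'I_(size q),
       (s (f i) < s (f j))%N == (nth 0%N q i < nth 0%N q j)%N]].

Definition involutions_avoiding (q : seq nat) (n : nat) : {set 'S_n} :=
  [set s : 'S_n | [forall i, s (s i) == i] && ~~ contains_pattern q s].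

(* The first down step at height h + 1 to the right of step i at height h.    *)
Definition partner (n : nat) (p : n.-tuple step) (i : 'I_n) : option 'I_n :=
  ohead [seq j : 'I_n <- enum 'I_n |
         [&& (i < j)%N, tnth p j == Down
           & height p j == height p i + 1]].

(* [lab i] is the label currently carried by step i. As (s * t) x = t (s x),  *)
(* [tperm i j * lab] is [lab] with the labels of steps i and j switched. On a *)
(* Motzkin path every up step has a partner, so the None case does not occur. *)
Definition switch_labels (n : nat) (p : n.-tuple step) (lab : 'S_n) (i : 'I_n)
    : 'S_n :=
  if partner p i is Some j then (tperm i j * lab)%g else lab.

Definition phi (n : nat) (p : n.-tuple step) : 'S_n :=
  foldl (switch_labels p) 1%g [seq i <- enum 'I_n | tnth p i == Up].

(* Main.v *)
Require Import Defs.
From mathcomp Require Import all_boot all_order all_fingroup all_algebra.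
From mathcomp Require Import zify.

Set Implicit Arguments.
Unset Strict Implicit.
Unset Printing Implicit Defensive.

Import Order.TTheory GRing.Theory Num.Theory.

(** Draw an involution as a set of arcs joining i to s i, together with isolated
fixed points.  Avoiding 3412 means exactly that no two arcs cross
([avoiding_noncrossing]).  A noncrossing diagram is the same thing as a Motzkin
path: left ends, right ends and fixed points become up, down and level steps
([path_of]), and conversely each up step is joined to the first down step that
brings the path back to its starting height ([motzkin_path_of]).  The map phi
exchanges the labels at the two ends of each such arc, so it inverts [path_of]
([phi_path_of]).  Since every Motzkin path is [path_of s] for a noncrossing
involution s, all three claims reduce to statements about s.

For the decreasing subsequences, two positions of a noncrossing diagram carry an
inversion exactly when their arcs are nested or equal (a fixed point being a
degenerate arc).  A set of positions is therefore decreasing when its arcs form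
a chain; such a nonempty set has a unique innermost position m, where of the two
ends of an arc the right one counts as more internal, and the remaining positions
form an arbitrary subset of [around m].  So the number of decreasing subsequences
of length K + 1 is the sum over m of the binomials of #|around m| over K
([card_decreasing]).  Finally the height of the path at m counts the arcs covering
m, each of which contributes its two ends to [around m], except that a right end
m is itself an end of one of these arcs: this gives 2 ht(m), or 2 ht(m) - 1 for
a down step ([card_around]). *)

(** * Noncrossing involutions and the pattern 3412 *)

Definition involutive_perm n (s : 'S_n) := forall i, s (s i) = i.

(** Only two left ends i < j <= s i < s j can violate this for an involution, so
it says that arcs do not cross; stated for arbitrary i and j, it also says
that the arcs of a non-inversion are separated. *)
Definition noncrossing n (s : 'S_n) :=
  forall i j : 'I_n, i < j -> s i < s j -> s i < j.

Lemma perm_val_neq n (s : 'S_n) (i j : 'I_n) :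
  (i : nat) <> j -> (s i : nat) <> s j.
Proof. by move=> nij /val_inj/perm_inj eij; apply: nij; rewrite eij. Qed.

Lemma noncrossing_lr n (s : 'S_n) : involutive_perm s -> noncrossing s ->
  forall i j : 'I_n, i < j -> s i < s j -> i < s j.
Proof. by move=> sK nc i j ij sij; rewrite -{1}[i]sK; apply: nc; rewrite ?sK. Qed.

(** Two crossing arcs i < j < s i < s j carry the values s i, s j, i, j, a 3412.
Conversely, for an occurrence a < b < c < d of 3412 the pairs (a, b) and (c, d) are
non-inversions, so s a < b < c < s d by separation, against s d < s a. *)
Lemma avoiding_noncrossing n (s : 'S_n) :
  s \in involutions_avoiding [:: 3; 4; 1; 2] n <->
  involutive_perm s /\ noncrossing s.
Proof.
rewrite inE; split.
  case/andP=> /forallP sK0 av; have sK : involutive_perm s by move=> i; apply/eqP.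
  split=> // i j ij sij; rewrite ltnNge; apply/negP=> jsi.
  have {}jsi : j < s i.
    rewrite ltn_neqAle jsi andbT; apply/eqP => /val_inj ej.
    by move: sij; rewrite ej sK -ej ltnNge ltnW.
  case/negP: av; apply/existsP.
  exists [ffun k : 'I_4 => nth i [:: i; j; s i; s j] k].
  apply/andP; split; apply/forallP=> -[[|[|[|[|//]]]] hk];
    apply/forallP=> -[[|[|[|[|//]]]] hl]; rewrite !ffunE /= ?sK; lia.
case=> sK nc; apply/andP; split; first by apply/forallP=> i; rewrite sK.
apply/negP=> /existsP[f /andP[/forallP f1 /forallP f2]].
pose o k (hk : k < 4) : 'I_(size [:: 3; 4; 1; 2]) := Ordinal hk.
pose a := f (@o 0 isT); pose b := f (@o 1 isT).
pose c := f (@o 2 isT); pose d := f (@o 3 isT).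
have ab : a < b by have /forallP/(_ (@o 1 isT)) := f1 (@o 0 isT).
have bc : b < c by have /forallP/(_ (@o 2 isT)) := f1 (@o 1 isT).
have cd : c < d by have /forallP/(_ (@o 3 isT)) := f1 (@o 2 isT).
have sab : s a < s b by have /forallP/(_ (@o 1 isT))/eqP := f2 (@o 0 isT).
have sda : s d < s a by have /forallP/(_ (@o 0 isT))/eqP := f2 (@o 3 isT).
have scd : s c < s d by have /forallP/(_ (@o 3 isT))/eqP := f2 (@o 2 isT).
have := nc _ _ ab sab; have := noncrossing_lr sK nc cd scd; lia.
Qed.

(** * From noncrossing involutions to paths *)

Definition arc_step (i j : nat) : step :=
  if i < j then Up else if j < i then Down else Level.

Definition path_of n (s : 'S_n) : n.-tuple step :=
  [tuple arc_step i (s i) | i < n].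

Lemma path_of_Up n (s : 'S_n) i : (tnth (path_of s) i == Up) = (i < s i).
Proof. by rewrite tnth_mktuple /arc_step; case: ltngtP. Qed.

Lemma path_of_Down n (s : 'S_n) i : (tnth (path_of s) i == Down) = (s i < i).
Proof. by rewrite tnth_mktuple /arc_step; case: ltngtP. Qed.

Definition over n (s : 'S_n) (m : nat) : {set 'I_n} :=
  [set x : 'I_n | x < m <= s x].

Lemma heightE n (p : n.-tuple step) m :
  height p m = (\sum_(i < n | (i < m)%N) rise (tnth p i))%R.
Proof.
rewrite /height; have [le_nm | /ltnW le_mn] := leqP n m.
  rewrite take_oversize ?size_tuple // big_tuple.
  by apply: eq_bigl => i; rewrite (leq_trans (ltn_ord i)).
have Ht : size (take m p) = m by rewrite size_takel ?size_tuple.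
rewrite (big_nth Level) Ht big_mkord.
rewrite (big_ord_widen_cond n xpredT (fun i => rise (nth Level (take m p) i))) //.
by apply: eq_bigr => i im; rewrite nth_take // (tnth_nth Level).
Qed.

(** The height counts the open arcs: left ends minus right ends before m, in which
an arc with both ends before m cancels out. *)
Lemma height_path_of n (s : 'S_n) m : involutive_perm s ->
  height (path_of s) m = (#|over s m|%:R)%R.
Proof.
move=> sK; rewrite heightE.
pose u := [set x : 'I_n | (x < m) && (x < s x)].
pose d := [set x : 'I_n | (x < m) && (s x < x)].
have -> : (\sum_(i < n | (i < m)%N) rise (tnth (path_of s) i) =
          #|u|%:R - #|d|%:R :> int)%R.
  rewrite -!sum1_card !natr_sum [in X in (X - _)%R]big_mkcond.
  rewrite [in X in (_ - X)%R]big_mkcond.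
  rewrite -sumrB big_mkcond; apply: eq_bigr => i _; rewrite !inE tnth_mktuple /arc_step.
  by case: (i < m); case: (ltngtP i (s i)).
(* Each right end in d is replaced by the left end of its arc. *)
have -> : #|d| = #|[set x : 'I_n | (x < s x) && (s x < m)]|.
  rewrite -(card_imset _ (@perm_inj _ s)); apply: eq_card => x.
  apply/imsetP/idP => [[y]|]; first by rewrite !inE => /andP[ym sy] ->; rewrite sK sy.
  by rewrite inE => /andP[xs sm]; exists (s x); rewrite ?sK // inE sK sm.
rewrite -(cardsID (over s m) u).
have -> : u :&: over s m = over s m by apply/setP=> x; rewrite !inE; lia.
have -> : u :\: over s m = [set x : 'I_n | (x < s x) && (s x < m)].
  by apply/setP=> x; rewrite !inE; lia.
by rewrite natrD addrK.
Qed.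

Lemma path_of_motzkin n (s : 'S_n) : involutive_perm s -> path_of s \in motzkin n.
Proof.
move=> sK; rewrite inE; apply/andP; split.
  by apply/forallP=> i; rewrite height_path_of.
rewrite height_path_of // (_ : over s n = set0) ?cards0 //.
by apply/setP=> x; rewrite !inE [n <= _]leqNgt !ltn_ord.
Qed.

(** Step j is where the path, after climbing at step i, first comes back to the
height of i. *)
Definition matched n (p : n.-tuple step) (i j : 'I_n) : Prop :=
  [/\ i < j, tnth p i = Up, tnth p j = Down, height p j = (height p i + 1)%R
    & forall k, i < k <= j -> (height p i < height p k)%R].

Lemma height0 p : height p 0 = 0%R.
Proof. by rewrite /height take0 big_nil. Qed.

Lemma heightS n (p : n.-tuple step) (i : 'I_n) :
  height p i.+1 = (height p i + rise (tnth p i))%R.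
Proof.
by rewrite /height (take_nth Level) ?size_tuple // -cats1 big_cat big_seq1
           (tnth_nth Level).
Qed.

Lemma ohead_filter_enum n (P : pred 'I_n) (j : 'I_n) :
  P j -> (forall k : 'I_n, k < j -> ~~ P k) -> ohead [seq k <- enum 'I_n | P k] = Some j.
Proof.
move=> Pj minj.
case E: [seq k <- enum 'I_n | P k] => [|k l] /=.
  have : j \in [seq k <- enum 'I_n | P k] by rewrite mem_filter Pj mem_enum.
  by rewrite E.
have so : sorted ltn [seq val k | k <- [seq k <- enum 'I_n | P k]].
  rewrite sorted_map; apply: sorted_filter; first by move=> ? ? ?; apply: ltn_trans.
  by rewrite -sorted_map val_enum_ord iota_ltn_sorted.
have Pk : P k.
  have : k \in [seq k <- enum 'I_n | P k] by rewrite E mem_head.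
  by rewrite mem_filter => /andP[].
have : j \in [seq k <- enum 'I_n | P k] by rewrite mem_filter Pj mem_enum.
rewrite E inE => /orP[/eqP-> //|jl].
move: so; rewrite E /= (path_sortedE ltn_trans) => /andP[/allP lt_k _].
have kj : k < j by apply: lt_k; apply: map_f.
by case/negP: (minj _ kj).
Qed.

(** An earlier down step from the same height would bring the path back to the
height of i too soon. *)
Lemma matched_partner n (p : n.-tuple step) i j :
  matched p i j -> partner p i = Some j.
Proof.
case=> ij _ pj hj ge; apply: ohead_filter_enum; first by rewrite ij pj hj !eqxx.
move=> k kj; apply/negP=> /and3P[ik /eqP pk /eqP hk].
have := ge k.+1; rewrite heightS pk hk /=; lia.
Qed.

(** The transpositions met by the fold are disjoint, so after treating the up steps
of l the labelling agrees with s on their arcs and is the identity elsewhere. *)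
Lemma foldl_switch n (p : n.-tuple step) (s : 'S_n) (l : seq 'I_n) :
    involutive_perm s -> uniq l ->
    (forall i, i \in l -> partner p i = Some (s i) /\ s i \notin l) ->
  forall x, foldl (switch_labels p) 1%g l x =
    if (x \in l) || (s x \in l) then s x else x.
Proof.
move=> sK; elim/last_ind: l => [|l i IHl] ul part x; first by rewrite perm1.
move: ul; rewrite rcons_uniq => /andP[il ul].
have [|parti] := part i; first by rewrite mem_rcons mem_head.
rewrite mem_rcons inE negb_or => /andP[sii sil].
have part' k : k \in l -> partner p k = Some (s k) /\ s k \notin l.
  move=> kl; have kl' : k \in rcons l i by rewrite mem_rcons inE kl orbT.
  by case: (part k kl'); rewrite mem_rcons inE negb_or => ? /andP[].
rewrite foldl_rcons /switch_labels parti permM !mem_rcons !inE IHl //.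
case: tpermP => [->|->|/eqP xi /eqP xsi].
- by rewrite sK (negPf sil) (negPf il) eqxx.
- by rewrite sK (negPf il) (negPf sil) eqxx orbT.
have sxi : s x != i by apply: contra xsi => /eqP <-; rewrite sK.
by rewrite (negPf xi) (negPf sxi).
Qed.

(** By [foldl_switch] it suffices that i < s i is matched with s i in the path.
Inside the arc, every arc open at i stays open because arcs do not cross, and
the arc of i is open in addition; at s i nothing else is open, because an arc
opened after i is closed before s i. *)
Lemma phi_path_of n (s : 'S_n) :
  involutive_perm s -> noncrossing s -> phi (path_of s) = s.
Proof.
move=> sK nc; apply/permP=> x; rewrite /phi.
have upE y : (y \in [seq i <- enum 'I_n | tnth (path_of s) i == Up]) = (y < s y).
  by rewrite mem_filter path_of_Up mem_enum andbT.
rewrite (foldl_switch sK).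
- rewrite !upE sK.
  by case: ltngtP => // /val_inj.
- by rewrite filter_uniq ?enum_uniq.
move=> i; rewrite !upE sK => isi.
split; last by lia.
have ge k : i < k <= s i -> i |: over s i \subset over s k.
  move=> ik; apply/subsetP=> x0; rewrite !inE => /orP[/eqP->//|/andP[xi sx]].
  have := nc _ _ xi; have := @perm_val_neq _ s x0 i; lia.
have cardU : #|i |: over s i| = #|over s i|.+1 by rewrite cardsU1 inE ltnn.
apply: matched_partner; split=> //.
- by apply/eqP; rewrite path_of_Up.
- by apply/eqP; rewrite path_of_Down sK.
- rewrite !height_path_of // natr1 -cardU; congr (_%:R)%R.
  apply: eq_card => x0; apply/idP/idP; last by apply: (subsetP (ge _ _)); rewrite isi leqnn.
  rewrite !inE; case: eqP => //= nxi.
  have := nc i x0; have := @perm_val_neq _ s x0 i.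
  have : (x0 : nat) <> i by move/val_inj.
  lia.
by move=> k /ge/subset_leq_card; rewrite cardU !height_path_of // ltr_nat.
Qed.

(** * From paths to noncrossing involutions *)

(** If i < j < s i < s j, the path at s i has come down to one above the height
of i, while it must still be above the height of j, itself above that of i. *)
Lemma matched_noncrossing n (p : n.-tuple step) (s : 'S_n) :
    involutive_perm s -> (forall k : 'I_n, k < s k -> matched p k (s k)) ->
  noncrossing s.
Proof.
move=> sK match_s i j ij sij; rewrite ltnNge; apply/negP=> jsi.
have jsi' : (j : nat) <> s i.
  by move=> /val_inj ej; move: sij; rewrite ej sK -ej; lia.
have [|_ _ _ hi gti] := match_s i; first lia.
have [|_ _ _ hj gtj] := match_s j; first lia.
have := gti j; have := gtj (s i); lia.
Qed.

Section Matching.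
Variables (n : nat) (p : n.-tuple step).
Hypothesis pM : p \in motzkin n.

Lemma motzkin_ge0 i : i <= n -> (0 <= height p i)%R.
Proof.
move: pM; rewrite inE => /andP[/forallP ge0 _] le_in.
by have := ge0 (Ordinal (le_in : i < n.+1)).
Qed.

Lemma motzkin_end : height p n = 0%R.
Proof. by move: pM; rewrite inE => /andP[_ /eqP]. Qed.

(** The path ends at height 0, so it returns to the height of i or below; steps
change the height by at most one, so the first return is by a down step and
at the height of i exactly. *)
Lemma matched_up i : tnth p i = Up -> exists j, matched p i j.
Proof.
move=> pi; have hi := motzkin_ge0 (ltnW (ltn_ord i)).
pose P k := [&& i < k, k <= n & (height p k <= height p i)%R].
have exP : exists k, P k by exists n; rewrite /P ltn_ord leqnn motzkin_end.
case: (ex_minnP exP) => -[|k] /and3P[// ik kn hk] mink.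
have {ik} ik : i < k.
  rewrite ltn_neqAle -ltnS ik andbT; apply/eqP=> eik.
  by move: hk; rewrite -eik heightS pi /=; lia.
have gt m : i < m <= k -> (height p i < height p m)%R.
  move=> /andP[im mk]; rewrite ltNge; apply/negP=> hm.
  by have := mink m; rewrite /P im hm (leq_trans mk (ltnW kn)); lia.
have := gt k; rewrite ik leqnn => /(_ isT) gtk.
exists (Ordinal kn); move: hk; have := heightS p (Ordinal kn); rewrite /= => ->.
case pk: (tnth p (Ordinal kn)) => /= hk; try lia.
split=> //=; lia.
Qed.

(** Mirror image of [matched_up]: the match is the last point before j strictly
below it, which exists because the path starts at height 0. *)
Lemma matched_down j : tnth p j = Down -> exists i, matched p i j.
Proof.
move=> pj; have := motzkin_ge0 (ltn_ord j); rewrite heightS pj /= => hj.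
pose P k := (k <= j) && (height p k < height p j)%R.
have exP : exists k, P k by exists 0; rewrite /P height0; lia.
have bd k : P k -> k <= j by case/andP.
case: (ex_maxnP exP bd) => k /andP[kj hk] maxk.
have {}kj : k < j by rewrite ltn_neqAle kj andbT; apply: contraTneq hk => ->; rewrite ltxx.
have gt m : k < m <= j -> (height p j <= height p m)%R.
  move=> /andP[km mj]; rewrite leNgt; apply/negP=> hm.
  by have := maxk m; rewrite /P mj hm; lia.
have kn := ltn_trans kj (ltn_ord j).
have := gt k.+1; rewrite ltnSn kj => /(_ isT).
move=> hk1; exists (Ordinal kn); move: hk1; have := heightS p (Ordinal kn); rewrite /= => ->.
case pk: (tnth p (Ordinal kn)) => /= h; try lia.
split=> //=; first lia.
by move=> m /gt; lia.
Qed.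

(** Every step that is not level has a match by [matched_up] and [matched_down], and
only one: the partner of an up step is unique by definition, and of two up steps
matched with the same down step the later one would start higher.  So exchanging
matched steps and fixing level steps is an involution. *)
Lemma motzkin_path_of :
  exists s : 'S_n, [/\ involutive_perm s, noncrossing s & path_of s = p].
Proof.
pose arc i j := (tnth p i == Up) && (partner p i == Some j).
have arcP i j : arc i j <-> matched p i j.
  split=> [/andP[/eqP pi /eqP pij]|m]; last first.
    by rewrite /arc (matched_partner m); case: m => _ -> _ _ _; rewrite !eqxx.
  have [j' m] := matched_up pi.
  by move: (matched_partner m); rewrite pij => -[->].
pose lk i j := arc i j || arc j i.
have lkC i j : lk i j = lk j i by rewrite /lk orbC.
have lk_step i j : lk i j -> tnth p i = arc_step i j.
  case/orP=> /arcP[ij p1 p2 _ _]; rewrite /arc_step ?p1 ?p2 ?ij //.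
  by rewrite ltnNge (ltnW ij).
have arc_inj i i' j : matched p i j -> matched p i' j -> i = i'.
  move=> [ij _ _ hi gt] [i'j _ _ hi' gt']; apply/val_inj/eqP.
  by case: ltngtP (gt i') (gt' i) => //; lia.
have lk_fun i j k : lk i j -> lk i k -> j = k.
  case/orP=> /arcP m /orP[] /arcP m'.
  - by move: (matched_partner m); rewrite (matched_partner m') => -[].
  - by case: m m' => _ a _ _ _ [_ _ b _ _]; rewrite a in b.
  - by case: m m' => _ _ a _ _ [_ b _ _ _]; rewrite a in b.
  exact: arc_inj m m'.
pose f i := odflt i [pick j | lk i j].
have lkf i : tnth p i <> Level -> lk i (f i).
  rewrite /f => pi; case: pickP => [//|nolk]; case E: (tnth p i) pi => // _.
    by have [j /arcP m] := matched_up E; move: (nolk j); rewrite /lk m.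
  by have [j /arcP m] := matched_down E; move: (nolk j); rewrite /lk m orbT.
have fL i : tnth p i = Level -> f i = i.
  rewrite /f => pi; case: pickP => [j|//].
  by case/orP=> /arcP[_ p1 p2 _ _]; rewrite pi in p1 p2.
have fK : involutive f.
  move=> i; case: (tnth p i =P Level) => [pi|pi]; first by rewrite !fL.
  have lki := lkf i pi; have := lki; rewrite lkC => lki'.
  apply: (lk_fun (f i)) => //; apply: lkf => pfi.
  by move: lki'; rewrite /lk => /orP[] /arcP[_ p1 p2 _ _]; rewrite pfi in p1 p2.
pose s := perm (inv_inj fK).
have sK : involutive_perm s by move=> i; rewrite !permE fK.
have ps : path_of s = p.
  apply: eq_from_tnth => i; rewrite tnth_mktuple permE.
  case: (tnth p i =P Level) => [pi|/lkf/lk_step->//].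
  by rewrite fL // /arc_step ltnn.
exists s; split=> //; apply: (@matched_noncrossing _ p) => // k ksk.
have pk : tnth p k = Up by apply/eqP; rewrite -ps path_of_Up.
have /lkf/orP[/arcP m|/arcP[fk _ _ _ _]] : tnth p k <> Level by rewrite pk.
  by rewrite permE.
by move: ksk; rewrite permE ltnNge ltnW.
Qed.
End Matching.

(** * Decreasing subsequences *)

Section Decreasing.
Variables (n : nat) (s : 'S_n).
Hypotheses (sK : involutive_perm s) (nc : noncrossing s).

(** Positions x whose arc is wrapped around m; for the arc of m itself, the left
end is around the right end but not conversely. *)
Definition around (m : 'I_n) : {set 'I_n} :=
  [set x : 'I_n | (x < m <= s x) || (s x < m < x)].

(** Positions to the left of m in [around m] are the left ends of the arcs open at
m, and those to the right are their right ends, where the arc ending at m is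
missing. *)
Lemma card_around m :
  (#|around m|%:Z = 2 * height (path_of s) m - (tnth (path_of s) m == Down)%:R)%R.
Proof.
rewrite height_path_of // path_of_Down.
pose r := [set x : 'I_n | s x < m < x].
have -> : around m = over s m :|: r by apply/setP=> x; rewrite !inE.
have -> : #|over s m :|: r| = #|over s m| + #|r|.
  rewrite cardsU (_ : _ :&: _ = set0) ?cards0 ?subn0 //.
  by apply/setP=> x; rewrite !inE; lia.
(* The arcs covering m correspond to their right ends, counted by r, except for
   the arc that ends at m itself. *)
suff E : #|over s m| = (s m < m) + #|r|.
  rewrite E !natz; case: (s m < m); move: #|r| => c; lia.
rewrite -[#|over s m|](cardsID [set x | s x == m]); congr (_ + _).
  rewrite (_ : _ :&: _ = if s m < m then [set s m] else set0).
    by case: ifP; rewrite ?cards1 ?cards0.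
  apply/setP=> x; rewrite !inE; case: eqP => [<-|nx].
    by rewrite sK leqnn !andbT; case: ifP; rewrite !inE // eqxx.
  rewrite andbF; case: ifP; rewrite !inE // => _.
  by apply/esym/eqP=> ex; apply: nx; rewrite ex sK.
rewrite -(card_imset _ (@perm_inj _ s)); apply: eq_card => x.
apply/imsetP/idP => [[y]|].
  rewrite !inE => /andP[nym /andP[ym my]] ->; rewrite sK ym /=.
  by rewrite ltn_neqAle my eq_sym nym.
rewrite inE => /andP[sm mx]; exists (s x); rewrite ?sK // !inE sK sm ltnW // !andbT.
by apply: contraTneq mx => ->; rewrite ltnn.
Qed.

Definition dec_pair (x y : 'I_n) := ((x < y) ==> (s y < s x)) && ((y < x) ==> (s x < s y)).

Lemma decreasing_pairs A :
  decreasing_on s A <-> {in A &, forall x y, dec_pair x y}.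
Proof.
split=> [/forall_inP dA x y xA yA|dA].
  by rewrite /dec_pair (forall_inP (dA x xA) y yA) (forall_inP (dA y yA) x xA).
apply/forall_inP=> x xA; apply/forall_inP=> y yA.
by have /andP[] := dA x y xA yA.
Qed.

(** Separated arcs give a non-inversion, so the arcs of an inversion are nested. *)
Lemma around_total x y : x != y -> dec_pair x y -> (x \in around y) || (y \in around x).
Proof.
move=> nxy; rewrite /dec_pair !inE.
have := nc (i := x) (j := s y); have := nc (i := y) (j := s x); rewrite !sK.
have := @perm_val_neq _ s x y; rewrite -(inj_eq val_inj) /= in nxy.
have : (s y = x :> nat) -> (s x = y :> nat) by move=> /val_inj <-; rewrite sK.
have : (s x = y :> nat) -> (s y = x :> nat) by move=> /val_inj <-; rewrite sK.
lia.
Qed.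

Lemma around_dec x m : x \in around m -> dec_pair x m.
Proof.
rewrite inE /dec_pair.
have := nc (i := x) (j := m); have := nc (i := m) (j := x).
have := noncrossing_lr sK nc (i := x) (j := m); have := noncrossing_lr sK nc (i := m) (j := x).
have := @perm_val_neq _ s x m.
lia.
Qed.

(** Two arcs wrapped around the same point cannot be separated. *)
Lemma around_dec2 x y m : x \in around m -> y \in around m -> dec_pair x y.
Proof.
rewrite !inE /dec_pair.
have := nc (i := x) (j := y); have := nc (i := y) (j := x).
have := noncrossing_lr sK nc (i := x) (j := y); have := noncrossing_lr sK nc (i := y) (j := x).
have := @perm_val_neq _ s x y.
lia.
Qed.

(** A numerical rank that makes [around] well founded: by left end of the arc,
then left end before right end within an arc. *)
Definition depth (x : 'I_n) := (minn x (s x)).*2 + (s x < x).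

Lemma around_depth x m : x \in around m -> depth x < depth m.
Proof.
rewrite inE /depth -!addnn.
have := nc (i := x) (j := m); have := nc (i := m) (j := x).
have := noncrossing_lr sK nc (i := x) (j := m); have := noncrossing_lr sK nc (i := m) (j := x).
have : (s x = m :> nat) -> (s m = x :> nat) by move=> /val_inj <-; rewrite sK.
have : (s m = x :> nat) -> (s x = m :> nat) by move=> /val_inj <-; rewrite sK.
have := @perm_val_neq _ s x m.
have := @perm_val_neq _ s x (s m).
have := @perm_val_neq _ s m (s x).
have := nc (i := s m) (j := x).
rewrite !sK.
lia.
Qed.

Definition innermost (A : {set 'I_n}) m := (m \in A) && (A :\ m \subset around m).

Lemma innermost_uniq A m m' : innermost A m -> innermost A m' -> m = m'.
Proof.
case/andP=> mA /subsetP Am /andP[m'A /subsetP Am']; apply/eqP; apply: contraT => nm.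
have := around_depth (Am m' _); have := around_depth (Am' m _).
by rewrite !in_setD1 mA m'A nm eq_sym nm; lia.
Qed.

(** A position of maximal [depth] in a decreasing set is innermost, as any two
positions of the set are comparable by [around_total]. *)
Lemma decreasing_innermost A :
  (exists m, innermost A m) <-> decreasing_on s A /\ A != set0.
Proof.
split=> [[m /andP[mA /subsetP Am]]|[/decreasing_pairs dA /set0Pn[x0 x0A]]].
  split; last by apply/set0Pn; exists m.
  have Am' x : x \in A -> x <> m -> x \in around m.
    by move=> xA /eqP xm; apply: Am; rewrite in_setD1 xm.
  apply/decreasing_pairs=> x y xA yA.
  case: (x =P m) (y =P m) => [->|xm] [->|ym].
  - by rewrite /dec_pair ltnn.
  - by rewrite /dec_pair andbC; apply: around_dec; apply: Am'.
  - by apply: around_dec; apply: Am'.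
  by apply: (@around_dec2 _ _ m); apply: Am'.
case: (arg_maxnP depth x0A) => m mA max_m; exists m; apply/andP; split=> //.
apply/subsetP=> x; rewrite in_setD1 => /andP[xm xA].
have := around_total xm (dA x m xA mA) => /orP[//|/around_depth].
by have /= := max_m x xA; lia.
Qed.

(** A set with innermost position m is m together with an arbitrary K-subset of [around m]. *)
Lemma card_innermost m K :
  #|[set A : {set 'I_n} | (#|A| == K.+1) && innermost A m]| = 'C(#|around m|, K).
Proof.
have mm : m \notin around m by rewrite inE !ltnn andbF.
rewrite -cards_draws.
have inj : {in [set B : {set 'I_n} | B \subset around m & #|B| == K] &,
            injective (fun B => m |: B)}.
  move=> B C; rewrite !inE => /andP[Bm _] /andP[Cm _] e.
  have mB : m \notin B by apply: contra mm; apply: subsetP.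
  have mC : m \notin C by apply: contra mm; apply: subsetP.
  by rewrite -(setU1K mB) e setU1K.
rewrite -(card_in_imset inj); apply: eq_card => A.
rewrite inE; apply/idP/imsetP => [/andP[cA /andP[mA Am]]|[B]].
  exists (A :\ m); last by rewrite setD1K.
  by rewrite inE Am /= -eqSS -(eqP cA) (cardsD1 m A) mA.
rewrite inE => /andP[Bm cB] ->.
have mB : m \notin B by apply: contra mm; apply: subsetP.
by rewrite cardsU1 mB (eqP cB) eqxx /innermost setU11 setU1K.
Qed.

(** Classify the decreasing sets by their innermost position. *)
Lemma card_decreasing K :
  #|[set A : {set 'I_n} | (#|A| == K.+1) && decreasing_on s A]|
    = \sum_m 'C(#|around m|, K).
Proof.
under eq_bigr do rewrite -card_innermost.
pose P := [set A : {set 'I_n} | (#|A| == K.+1) && decreasing_on s A].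
under eq_bigr do rewrite -sum1_card.
rewrite (exchange_big_dep (mem P)) /=; last first.
  move=> m A _; rewrite !inE => /andP[-> iA] /=.
  by have [] := (decreasing_innermost A).1 (ex_intro _ m iA).
rewrite -sum1_card; apply: eq_bigr => A.
rewrite inE => /andP[/eqP cA dA].
have [|m iA] := (decreasing_innermost A).2.
  by split; rewrite // -card_gt0 cA.
rewrite sum1_card (@eq_card _ _ (pred1 m)) ?card1 // => m'.
transitivity (innermost A m'); last first.
  by apply/idP/eqP => [iA'|-> //]; apply: innermost_uniq iA' iA.
rewrite -[LHS]/(A \in [set B : {set 'I_n} | (#|B| == K.+1) && innermost B m']).
by rewrite inE cA eqxx.
Qed.

Lemma path_tauE k :
  path_tau k (path_of s) = \sum_m binz (Posz #|around m|) (k - 1)%R.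
Proof.
rewrite [RHS](bigID (fun m => tnth (path_of s) m == Down)) /= addnC /path_tau.
congr (_ + _); apply: eq_bigr => m pm; first by rewrite card_around (negPf pm) subr0.
by rewrite card_around pm.
Qed.

Lemma perm_tau_path_of k : perm_tau k s = path_tau k (path_of s).
Proof.
rewrite path_tauE /perm_tau; case: ifP => k1; last first.
  by rewrite big1 // => m _; rewrite /binz ifF //; lia.
have [K ->] : exists K : nat, k = Posz K.+1 by exists `|k|.-1; lia.
rewrite -[LHS]/(#|[set A : {set 'I_n} | (#|A| == K.+1) && decreasing_on s A]|).
rewrite card_decreasing; have -> : (Posz K.+1 - 1 = Posz K)%R by lia.
apply: eq_bigr => m _; rewrite /binz /=.
by case: ifP => // /negbT; rewrite lez_nat -ltnNge => /bin_small.
Qed.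
End Decreasing.

Theorem proposition2p13 (n : nat) :
  [/\ {in motzkin n &, injective (@phi n)},
      [set phi p | p in motzkin n]
        = involutions_avoiding [:: 3; 4; 1; 2] n
    & forall (k : int) (p : n.-tuple step), p \in motzkin n ->
        perm_tau k (phi p) = path_tau k p].
Proof.
split.
- move=> p q /motzkin_path_of[s [sK nc <-]] /motzkin_path_of[t [tK nct <-]].
  by rewrite !phi_path_of // => ->.
- apply/setP=> s; apply/imsetP/idP => [[p /motzkin_path_of[t [tK nct <-]] ->]|].
    by rewrite phi_path_of //; apply/avoiding_noncrossing.
  case/avoiding_noncrossing=> sK nc; exists (path_of s); first exact: path_of_motzkin.
  by rewrite phi_path_of.
move=> k p /motzkin_path_of[s [sK nc <-]].
by rewrite phi_path_of // perm_tau_path_of.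
Qed.
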